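(* Regular finite decomposition complexity satisfies Finite Amalgamation Permanence, Finite Union Permanence, Union Permanence, and Limit Permanence; that is, the collection $\mathfrak{R}$ of all metric families with regular finite decomposition complexity satisfies these four permanence properties.
   Context: A metric family is a set of metric spaces. A map of metric families $F\colon\mathcal{X}\to\mathcal{Y}$ is a collection of functions $f\colon X\to Y$ with $X\in\mathcal{X}$, $Y\in\mathcal{Y}$, such that each element of $\mathcal{X}$ is the domain of at least one function in $F$. $F$ is coarse if there is a non-decreasing function $\rho\colon[0,\infty)\to[0,\infty)$ with $d_Y(f(x),f(y))\le\rho(d_X(x,y))$ for all $f\colon X\to Y$ in $F$ and $x,y\in X$. A subfamily of $\mathcal{Y}$ is a metric family each of whose members is a subspace of some $Y\in\mathcal{Y}$; the inverse image of a subfamily $\mathcal{B}$ is $F^{-1}(\mathcal{B})=\{f^{-1}(B)\mid B\in\mathcal{B},\ f\in F\}$ (where $B$ is a subspace of the codomain of $f$). $\mathcal{X}$ is bounded if $\sup_{X\in\mathcal{X}}\operatorname{diam}X<\infty$. A collection of subspaces is $r$-disjoint if points in two distinctly indexed members have distance $>r$; an $r$-disjoint union is the union of an $r$-disjoint collection. $\operatorname{asdim}(\mathcal{X})\le n$ means: for every $r>0$, each $X\in\mathcal{X}$ has a decomposition $X=X_0\cup\dots\cup X_n$ where each $X_i$ is an $r$-disjoint union of subspaces $X_{ij}$, $j\in J_i$, such that the family of all $X_{ij}$ (over all $X$, $i$, $j$) is bounded. $\mathcal{X}$ has finite asymptotic dimension if $\operatorname{asdim}(\mathcal{X})\le n$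 for some $n$. Let $\mathfrak{R}_0$ be the collection of bounded metric families. For an ordinal $\alpha>0$, $\mathcal{X}\in\mathfrak{R}_\alpha$ if there are a metric family $\mathcal{Y}$ with finite asymptotic dimension and a coarse map $F\colon\mathcal{X}\to\mathcal{Y}$ such that for every bounded subfamily $\mathcal{B}$ of $\mathcal{Y}$ there is an ordinal $\beta<\alpha$ with $F^{-1}(\mathcal{B})\in\mathfrak{R}_\beta$. A metric family has regular finite decomposition complexity (regular FDC), i.e. lies in $\mathfrak{R}$, if it lies in $\mathfrak{R}_\alpha$ for some countable ordinal $\alpha$. Let $\mathfrak{C}$ be a collection of metric families. - Finite Amalgamation Permanence: if $\mathcal{X}=\bigcup_{i=1}^n\mathcal{X}_i$ and each $\mathcal{X}_i\in\mathfrak{C}$, then $\mathcal{X}\in\mathfrak{C}$. - Finite Union Permanence: for $n\in\mathbb{N}$ and $\mathcal{X}_1,\dots,\mathcal{X}_n\in\mathfrak{C}$, if $\mathcal{X}$ is a metric family such that for each $X\in\mathcal{X}$ there exist $X_i\in\mathcal{X}_i$, $1\le i\le n$, with $X=\bigcup_{i=1}^nX_i$, then $\mathcal{X}\in\mathfrak{C}$. - Union Permanence: let $\mathcal{X}=\{X_i\}_{i\in I}$ be a metric family in which each $X_i$ is a union of subspaces $X_i=\bigcup_{j\in J_i}X_{ij}$. If $\{X_{ij}\mid i\in I,j\in J_i\}\in\mathfrak{C}$ and for each $r>0$ there exist subspaces $Y_i(r)\subseteq X_i$ such that $\{Y_i(r)\}_{i\in I}\in\mathfrak{C}$ and $\{X_{ij}\setminus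 Y_i(r)\mid j\in J_i\}$ is an $r$-disjoint collection for each $i\in I$, then $\mathcal{X}\in\mathfrak{C}$. - Limit Permanence: let $\mathcal{X}=\{X_i\}_{i\in I}$ be a metric family. If for every $R>0$ there exist an indexing set $J_R$ and, for each $i\in I$, a decomposition of $X_i$ as an $R$-disjoint union of subspaces $\{Y_{ij}\mid j\in J_R\}$ such that $\{Y_{ij}\mid i\in I,j\in J_R\}\in\mathfrak{C}$, then $\mathcal{X}\in\mathfrak{C}$. *)

(* Defs.v *)
From Stdlib Require Import Reals ProofIrrelevance.
Open Scope R_scope.

Set Implicit Arguments.
Unset Strict Implicit.

(** * Metric families *)

Definition subspace_dist (X : Metric_Space) (A : Base X -> Prop)
    (x y : {x : Base X | A x}) : R :=
  dist X (proj1_sig x) (proj1_sig y).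

Lemma subspace_dist_refl (X : Metric_Space) (A : Base X -> Prop)
    (x y : {x : Base X | A x}) : subspace_dist x y = 0 <-> x = y.
Proof.
unfold subspace_dist; split.
- intros H; apply dist_refl in H.
  destruct x as [x hx], y as [y hy]; simpl in H.
  now apply subset_eq_compat.
- intros ->; now apply dist_refl.
Qed.

Definition subspace (X : Metric_Space) (A : Base X -> Prop) : Metric_Space :=
  {| Base := {x : Base X | A x};
     dist := @subspace_dist X A;
     dist_pos := fun x y => dist_pos X (proj1_sig x) (proj1_sig y);
     dist_sym := fun x y => dist_sym X (proj1_sig x) (proj1_sig y);
     dist_refl := @subspace_dist_refl X A;
     dist_tri := fun x y z =>
       dist_tri X (proj1_sig x) (proj1_sig y) (proj1_sig z) |}.

(** A metric space [M] given independently of [X] "is" the subspace [A] of [X]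
    when it is identified with [A] by an isometry: literal equality of
    [M] with [subspace A] would be too strict, since for instance [X] itself
    is not literally equal to its improper subspace. *)
Definition is_subspace (M X : Metric_Space) (A : Base X -> Prop) : Prop :=
  exists e : Base M -> Base X,
    (forall m m', dist X (e m) (e m') = dist M m m') /\
    (forall x, A x <-> exists m, e m = x).

Definition metric_family := Metric_Space -> Prop.

(** The family {X_i | i in I}. *)
Definition range (I : Type) (X : I -> Metric_Space) : metric_family :=
  fun M => exists i, M = X i.

(** The supremum of the diameters of the members is finite iff the set of all
    distances realised in members is bounded above. *)
Definition bounded (XX : metric_family) : Prop :=
  bound (fun d => exists X, XX X /\ exists x y, d = dist X x y).

(** A set of pairs (Y, B) with B a subset of Y; recording the ambient space Y
    makes sense of "B is a subspace of the codomain of f" below. *)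
Definition subspaces := forall Y : Metric_Space, (Base Y -> Prop) -> Prop.

Definition is_subfamily (BB : subspaces) (YY : metric_family) : Prop :=
  forall Y (B : Base Y -> Prop), BB Y B -> YY Y.

Definition family_of (BB : subspaces) : metric_family :=
  fun M => exists Y (B : Base Y -> Prop), BB Y B /\ M = subspace B.

(** A set of functions between metric spaces. *)
Definition functions := forall X Y : Metric_Space, (Base X -> Base Y) -> Prop.

Definition is_family_map (XX YY : metric_family) (F : functions) : Prop :=
  (forall X Y f, F X Y f -> XX X /\ YY Y) /\
  (forall X, XX X -> exists Y f, F X Y f).

(** [rho] is a function [0,oo) -> [0,oo): its values at negative arguments are
    irrelevant. *)
Definition coarse (F : functions) : Prop :=
  exists rho : R -> R,
    (forall t, 0 <= t -> 0 <= rho t) /\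
    (forall s t, 0 <= s -> s <= t -> rho s <= rho t) /\
    (forall X Y f, F X Y f ->
       forall x y, dist Y (f x) (f y) <= rho (dist X x y)).

Definition inverse_image (F : functions) (BB : subspaces) : metric_family :=
  fun M => exists X Y (f : Base X -> Base Y) (B : Base Y -> Prop),
    F X Y f /\ BB Y B /\ M = subspace (fun x => B (f x)).

(** * Asymptotic dimension *)

Definition r_disjoint (r : R) (X : Metric_Space) (J : Type)
    (U : J -> Base X -> Prop) : Prop :=
  forall j k, j <> k -> forall x y, U j x -> U k y -> dist X x y > r.

Definition asdim_le (XX : metric_family) (n : nat) : Prop :=
  forall r, 0 < r ->
  exists (J : Metric_Space -> nat -> Type)
         (U : forall (X : Metric_Space) (i : nat), J X i -> Base X -> Prop),
    (forall X, XX X ->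
       (forall x, exists i j, (i <= n)%nat /\ U X i j x) /\
       (forall i, (i <= n)%nat -> r_disjoint r (U X i))) /\
    bounded (fun M => exists X i (j : J X i),
               XX X /\ (i <= n)%nat /\ M = subspace (U X i j)).

Definition finite_asdim (XX : metric_family) : Prop :=
  exists n, asdim_le XX n.

(** * Ordinals, as (order types of) well-ordered types *)

Record ordinal := Ordinal {
  ord_carrier :> Type;
  ord_rel : ord_carrier -> ord_carrier -> Prop;
  ord_rel_wf : well_founded ord_rel;
  ord_rel_trans : forall x y z, ord_rel x y -> ord_rel y z -> ord_rel x z;
  ord_rel_total : forall x y, ord_rel x y \/ x = y \/ ord_rel y x
}.

(** [b < a]: [b] is isomorphic to a proper initial segment of [a]. *)
Definition ord_lt (b a : ordinal) : Prop :=
  exists (f : b -> a) (t : a),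
    (forall x y, ord_rel x y -> ord_rel (f x) (f y)) /\
    (forall z, ord_rel z t <-> exists x, f x = z).

Definition ord_is_zero (a : ordinal) : Prop := ~ inhabited a.

Definition ord_countable (a : ordinal) : Prop :=
  exists g : a -> nat, forall x y, g x = g y -> x = y.

(** * Regular finite decomposition complexity *)

(** [R_class a XX] : the metric family [XX] belongs to R_a. *)
Inductive R_class : ordinal -> metric_family -> Prop :=
| R_class_zero (a : ordinal) (XX : metric_family) :
    ord_is_zero a -> bounded XX -> R_class a XX
| R_class_pos (a : ordinal) (XX YY : metric_family) (F : functions) :
    ~ ord_is_zero a ->
    finite_asdim YY -> is_family_map XX YY F -> coarse F ->
    (forall BB, is_subfamily BB YY -> bounded (family_of BB) ->
       exists b, ord_lt b a /\ R_class b (inverse_image F BB)) ->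
    R_class a XX.

Definition regular_FDC (XX : metric_family) : Prop :=
  exists a, ord_countable a /\ R_class a XX.

(** * Permanence properties of a collection of metric families *)

Definition finite_amalgamation_permanence (C : metric_family -> Prop) : Prop :=
  forall (n : nat) (XXs : nat -> metric_family) (XX : metric_family),
    (forall i, (1 <= i <= n)%nat -> C (XXs i)) ->
    (forall X, XX X <-> exists i, (1 <= i <= n)%nat /\ XXs i X) ->
    C XX.

Definition finite_union_permanence (C : metric_family -> Prop) : Prop :=
  forall (n : nat) (XXs : nat -> metric_family) (XX : metric_family),
    (forall i, (1 <= i <= n)%nat -> C (XXs i)) ->
    (forall X, XX X ->
       exists A : nat -> Base X -> Prop,
         (forall i, (1 <= i <= n)%nat ->
            exists M, XXs i M /\ is_subspace M (A i)) /\
         (forall x, exists i, (1 <= i <= n)%nat /\ A i x)) ->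
    C XX.

Definition union_permanence (C : metric_family -> Prop) : Prop :=
  forall (I : Type) (X : I -> Metric_Space) (J : I -> Type)
         (U : forall i, J i -> Base (X i) -> Prop),
    (forall i x, exists j, U i j x) ->
    C (fun M => exists i j, M = subspace (U i j)) ->
    (forall r, 0 < r ->
       exists Y : forall i, Base (X i) -> Prop,
         C (range (fun i => subspace (Y i))) /\
         (forall i, r_disjoint r (fun (j : J i) x => U i j x /\ ~ Y i x))) ->
    C (range X).

Definition limit_permanence (C : metric_family -> Prop) : Prop :=
  forall (I : Type) (X : I -> Metric_Space),
    (forall r, 0 < r ->
       exists (J : Type) (Y : forall i, J -> Base (X i) -> Prop),
         (forall i, (forall x, exists j, Y i j x) /\ r_disjoint r (Y i)) /\
         C (fun M => exists i j, M = subspace (Y i j))) ->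
    C (range X).

(* Main.v *)
From Stdlib Require Import Reals Lra Lia ZArith Arith Cantor.
From Stdlib Require Import Classical ClassicalEpsilon.
From Stdlib Require Import FunctionalExtensionality PropExtensionality.
From Stdlib Require Import ProofIrrelevance Relation_Operators Lexicographic_Product.
Require Import Defs.


(** Ordinals disappear from the problem at once. A bounded subfamily of the
    target of a coarse map consists of subspaces of diameter at most N for some
    natural number N, so only countably many inverse images matter, and regular
    FDC is the least class [reg] that contains the bounded families and the
    families admitting a coarse map to a family of finite asymptotic dimension
    whose inverse images of N-bounded subspaces lie in the class for every N.
    Countability of the ordinal is then automatic: given countable ordinals for
    all N, the successor of their sum works ([regular_FDC_reg]).

    On [reg] each permanence property needs a single new coarse map.

    - Amalgamation: two coarse maps into YY1 and YY2 are one coarse map into the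
      union of YY1 and YY2, and one inducts on both families.

    - Unions: let X be the union of the U_j, let Y_m be such that the sets
      U_j minus Y_m are (m+1)-disjoint, and let V_n be the n-neighborhood of the
      union of Y_1, ..., Y_(n+1). The height of x is the least n with x in V_n.
      Sending x to the point at that height on the spoke of a hedgehog labelled
      by the U_j chosen for x is coarse: heights are Lipschitz at large scale,
      and points at distance at most n with different labels cannot both avoid
      V_n, so they have height O(n). Hedgehogs have asymptotic dimension at
      most 1. A bounded part of the hedgehog lies either on one spoke, and its
      preimage is in some U_j, or near the center, and its preimage is in some
      V_N ([filtration_map]). The union of two subspaces A and B is the instance
      where every Y_m is A and, outside A, the only label is B. It is proved
      first, because it shows that the sets V_n form a family in [reg].

    - Limits: let x and y be n-equivalent when they lie in the same piece of the
      (m+1)-disjoint decomposition for every m >= n. These equivalence relations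
      grow with n and relate any two points at distance at most n, so the least
      n for which x and y are n-equivalent is, up to a shift, an ultrametric
      controlled by the distance. Ultrametric spaces have asymptotic dimension
      0, and a set of ultrametric diameter N lies in one piece
      ([disjoint_pieces_ultrametric]). *)

Set Implicit Arguments.
Unset Strict Implicit.
Local Open Scope R_scope.

(** * Distances, bounded families and choice *)

Definition diam_le (D : R) (X : Metric_Space) (B : Base X -> Prop) : Prop :=
  forall x y, B x -> B y -> dist X x y <= D.

Definition control (rho : R -> R) : Prop :=
  (forall t, 0 <= t -> 0 <= rho t) /\
  (forall s t, 0 <= s -> s <= t -> rho s <= rho t).

Definition family_union (XX1 XX2 : metric_family) : metric_family :=
  fun M => XX1 M \/ XX2 M.

Lemma dist_nonneg (X : Metric_Space) (x y : Base X) : 0 <= dist X x y.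
Proof. pose proof (dist_pos X x y); lra. Qed.

Lemma dist_self (X : Metric_Space) (x : Base X) : dist X x x = 0.
Proof. now apply dist_refl. Qed.

Lemma nat_ceil (t : R) : 0 <= t -> exists n, t <= INR n <= t + 1.
Proof.
intros ht; destruct (archimed t) as [h1 h2].
exists (Z.to_nat (up t)).
rewrite INR_IZR_INZ, Z2Nat.id; [lra|].
apply le_IZR; lra.
Qed.

Lemma choice_fun (A B : Type) (P : A -> B -> Prop) :
  (forall a, exists b, P a b) -> exists f, forall a, P a (f a).
Proof.
intros H.
exists (fun a => proj1_sig (constructive_indefinite_description _ (H a))).
intros a; apply (proj2_sig (constructive_indefinite_description _ (H a))).
Qed.

Lemma bounded_iff (XX : metric_family) :
  bounded XX <-> exists D, forall X, XX X -> forall x y, dist X x y <= D.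
Proof.
split.
- intros [D hD]; exists D; intros X hX x y; apply hD; eauto 6.
- intros [D hD]; exists D; intros d (X & hX & x & y & ->); auto.
Qed.

(** * Asymptotic dimension *)

(** A decomposition into pieces indexed by a color in [0, n] and a key: the
    pieces of one color are [r]-disjoint and all have diameter at most [D]. *)
Definition coloring (r D : R) (n : nat) (X : Metric_Space) : Prop :=
  exists (K : Type) (c : Base X -> nat) (k : Base X -> K),
    (forall x, (c x <= n)%nat) /\
    (forall x y, c x = c y -> k x = k y -> dist X x y <= D) /\
    (forall x y, c x = c y -> k x <> k y -> dist X x y > r).

(** Overlaps in a decomposition can be removed by choosing for each point one
    piece containing it; the form obtained speaks of one space at a time, so
    that decompositions of different families combine freely. *)
Lemma asdim_leP (XX : metric_family) (n : nat) :
  asdim_le XX n <->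
  forall r, 0 < r -> exists D, forall X, XX X -> coloring r D n X.
Proof.
split; intros H r hr.
- destruct (H r hr) as (J & U & HX & [D hD]%bounded_iff).
  exists D; intros X hX; destruct (HX X hX) as [cov disj].
  (* Taking the piece itself as key, rather than its index, keeps the type of
     keys independent of the color. *)
  assert (Hc : forall x : Base X, exists p : nat * (Base X -> Prop),
    (fst p <= n)%nat /\ snd p x /\ exists j, snd p = U X (fst p) j).
  { intros x; destruct (cov x) as (i & j & hi & hx).
    exists (i, U X i j); simpl; eauto. }
  apply choice_fun in Hc as [f hf].
  exists (Base X -> Prop), (fun x => fst (f x)), (fun x => snd (f x)).
  split; [|split]; [intros x; apply hf| |]; intros x y hc hk.
  + destruct (hf x) as (hi & hx & j & ej); destruct (hf y) as (_ & hy & _).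
    rewrite <- hk, ej in hy; rewrite ej in hx.
    apply (hD (subspace (U X (fst (f x)) j))
             (ex_intro _ X (ex_intro _ _ (ex_intro _ j (conj hX (conj hi eq_refl)))))
             (exist _ x hx) (exist _ y hy)).
  + destruct (hf x) as (hi & hx & j & ej); destruct (hf y) as (_ & hy & ey).
    rewrite <- hc in ey; destruct ey as [l el]; rewrite ej in hx; rewrite el in hy.
    apply (disj (fst (f x)) hi j l); auto.
    intros <-; apply hk; congruence.
- destruct (H r hr) as [D hD].
  assert (Hc : forall X : Metric_Space, exists p : {K : Type & ((Base X -> nat) * (Base X -> K))%type},
     XX X -> (forall x, (fst (projT2 p) x <= n)%nat) /\
    (forall x y, fst (projT2 p) x = fst (projT2 p) y ->
        snd (projT2 p) x = snd (projT2 p) y -> dist X x y <= D) /\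
    (forall x y, fst (projT2 p) x = fst (projT2 p) y ->
       snd (projT2 p) x <> snd (projT2 p) y -> dist X x y > r)).
  { intros X.
    pose (T (K : Type) := ((Base X -> nat) * (Base X -> K))%type).
    destruct (classic (XX X)) as [hX|hX].
    - destruct (hD X hX) as (K & c & k & h); exists (existT T K (c, k)); auto.
    - exists (existT T (unit : Type) (fun _ => O, fun _ => tt)); contradiction. }
  pose (p X := proj1_sig (constructive_indefinite_description _ (Hc X))).
  assert (hp := fun X => proj2_sig (constructive_indefinite_description _ (Hc X))).
  fold p in hp; cbv beta in hp.
  exists (fun X _ => projT1 (p X)),
    (fun X i j x => fst (projT2 (p X)) x = i /\ snd (projT2 (p X)) x = j).
  split.
  + intros X hX; destruct (hp X hX) as (h1 & h2 & h3); split.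
    * intros x; exists (fst (projT2 (p X)) x), (snd (projT2 (p X)) x); auto.
    * intros i hi j k hjk x y [hx1 hx2] [hy1 hy2].
      apply h3; [exact (eq_trans hx1 (eq_sym hy1))|].
      intros e; apply hjk; rewrite <- hx2, <- hy2; exact e.
  + apply bounded_iff; exists D.
    intros M (X & i & j & hX & hi & ->) [x [hx1 hx2]] [y [hy1 hy2]].
    apply (hp X hX); [exact (eq_trans hx1 (eq_sym hy1))|exact (eq_trans hx2 (eq_sym hy2))].
Qed.

Lemma finite_asdim_bounded (XX : metric_family) : bounded XX -> finite_asdim XX.
Proof.
intros [D hD]%bounded_iff; exists O; apply asdim_leP; intros r hr; exists D.
intros X hX; exists unit, (fun _ => O), (fun _ => tt).
split; [auto|split]; auto; congruence.
Qed.

Lemma finite_asdim_union (XX1 XX2 : metric_family) :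
  finite_asdim XX1 -> finite_asdim XX2 -> finite_asdim (family_union XX1 XX2).
Proof.
intros [n1 h1] [n2 h2]; exists (Nat.max n1 n2); apply asdim_leP; intros r hr.
destruct (proj1 (asdim_leP _ _) h1 r hr) as [D1 hD1].
destruct (proj1 (asdim_leP _ _) h2 r hr) as [D2 hD2].
exists (Rmax D1 D2).
pose proof (Rmax_l D1 D2); pose proof (Rmax_r D1 D2).
intros X [hX|hX].
- destruct (hD1 X hX) as (K & c & k & a & b & d); exists K, c, k.
  split; [|split]; auto.
  + intros x; specialize (a x); lia.
  + intros x y e1 e2; specialize (b x y e1 e2); lra.
- destruct (hD2 X hX) as (K & c & k & a & b & d); exists K, c, k.
  split; [|split]; auto.
  + intros x; specialize (a x); lia.
  + intros x y e1 e2; specialize (b x y e1 e2); lra.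
Qed.

Definition is_ultrametric (X : Metric_Space) : Prop :=
  forall x y z, dist X x z <= Rmax (dist X x y) (dist X y z).

(** In an ultrametric space the closed balls of radius [r] partition the space,
    and points of different balls are at distance more than [r]. *)
Lemma finite_asdim_ultrametric : finite_asdim is_ultrametric.
Proof.
exists O; apply asdim_leP; intros r hr; exists r; intros X hX.
exists (Base X -> Prop), (fun _ => O), (fun x y => dist X x y <= r).
split; [auto|split]; intros x y _ hk.
- pose proof (f_equal (fun P => P y) hk) as e; simpl in e.
  rewrite e, dist_self; lra.
- apply Rnot_le_gt; intros hxy; apply hk.
  apply functional_extensionality; intros z; apply propositional_extensionality.
  split; intros h.
  + eapply Rle_trans; [apply (hX y x z)|]; apply Rmax_lub; [rewrite dist_sym|]; auto.
  + eapply Rle_trans; [apply (hX x y z)|]; apply Rmax_lub; auto.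
Qed.

(** * Hedgehogs *)

(** Spokes indexed by [J], each a copy of the natural numbers. The summand 1
    keeps the feet of different spokes apart, so that no quotient is needed. *)
Definition hedgehog_dist (J : Type) (p q : J * nat) : R :=
  if excluded_middle_informative (fst p = fst q)
  then Rabs (INR (snd p) - INR (snd q))
  else INR (snd p) + INR (snd q) + 1.

Ltac hedgehog_cases :=
  simpl; unfold hedgehog_dist; simpl;
  repeat (destruct excluded_middle_informative);
  try congruence; unfold Rabs; repeat destruct Rcase_abs.

Lemma hedgehog_dist_pos (J : Type) (p q : J * nat) : hedgehog_dist p q >= 0.
Proof.
pose proof (pos_INR (snd p)); pose proof (pos_INR (snd q)).
hedgehog_cases; lra.
Qed.

Lemma hedgehog_dist_sym (J : Type) (p q : J * nat) :
  hedgehog_dist p q = hedgehog_dist q p.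
Proof. hedgehog_cases; lra. Qed.

Lemma hedgehog_dist_refl (J : Type) (p q : J * nat) :
  hedgehog_dist p q = 0 <-> p = q.
Proof.
destruct p as [j m], q as [k l].
pose proof (pos_INR m); pose proof (pos_INR l).
split; [|intros [= <- <-]; hedgehog_cases; lra].
hedgehog_cases; intros h; try lra.
all: f_equal; [auto|apply INR_eq; lra].
Qed.

Lemma hedgehog_dist_tri (J : Type) (p q s : J * nat) :
  hedgehog_dist p q <= hedgehog_dist p s + hedgehog_dist s q.
Proof.
pose proof (pos_INR (snd p)); pose proof (pos_INR (snd q)).
pose proof (pos_INR (snd s)).
hedgehog_cases; lra.
Qed.

Definition hedgehog (J : Type) : Metric_Space :=
  {| Base := J * nat;
     dist := @hedgehog_dist J;
     dist_pos := @hedgehog_dist_pos J;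
     dist_sym := @hedgehog_dist_sym J;
     dist_refl := @hedgehog_dist_refl J;
     dist_tri := @hedgehog_dist_tri J |}.

Definition is_hedgehog (M : Metric_Space) : Prop := exists J, M = hedgehog J.

(** Cut the spokes into blocks of length L >= r, colored by parity, and merge
    all the blocks at height less than L into one piece. Blocks of equal parity
    on one spoke are separated by a whole block, and higher blocks on different
    spokes are separated by the path through the center. *)
Lemma finite_asdim_hedgehog : finite_asdim is_hedgehog.
Proof.
exists 1%nat; apply asdim_leP; intros r hr.
destruct (nat_ceil (Rlt_le _ _ hr)) as (L & hL & _).
assert (hL0 : L <> O) by (intros ->; simpl in hL; lra).
exists (2 * INR L).
intros M [J ->].
exists (option (J * nat)),
  (fun p => ((snd p / L) mod 2)%nat),
  (fun p => if (snd p / L =? 0)%nat then None else Some (fst p, (snd p / L)%nat)).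
split; [|split].
- intros p; pose proof (Nat.mod_upper_bound (snd p / L) 2 ltac:(lia)).
  apply Nat.lt_succ_r; auto.
- intros [j m] [k l] _; simpl.
  pose proof (Nat.div_mod_eq m L); pose proof (Nat.mod_upper_bound m L hL0).
  pose proof (Nat.div_mod_eq l L); pose proof (Nat.mod_upper_bound l L hL0).
  set (a := (m / L)%nat) in *; set (b := (l / L)%nat) in *.
  destruct (Nat.eqb_spec a 0), (Nat.eqb_spec b 0); try discriminate.
  + intros _.
    assert (m + 1 <= L)%nat by lia; assert (l + 1 <= L)%nat by lia.
    apply le_INR in H3, H4; rewrite plus_INR in H3, H4; simpl in H3, H4.
    pose proof (pos_INR m); pose proof (pos_INR l).
    hedgehog_cases; lra.
  + intros [= <- e].
    assert (m <= l + L)%nat by nia; assert (l <= m + L)%nat by nia.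
    apply le_INR in H3, H4; rewrite plus_INR in H3, H4.
    pose proof (pos_INR L).
    hedgehog_cases; lra.
- intros [j m] [k l]; simpl; intros hc hk.
  pose proof (Nat.div_mod_eq m L); pose proof (Nat.mod_upper_bound m L hL0).
  pose proof (Nat.div_mod_eq l L); pose proof (Nat.mod_upper_bound l L hL0).
  set (a := (m / L)%nat) in *; set (b := (l / L)%nat) in *.
  change (a mod 2 = b mod 2)%nat in hc.
  pose proof (Nat.div_mod_eq a 2); pose proof (Nat.div_mod_eq b 2).
  pose proof (pos_INR m); pose proof (pos_INR l).
  destruct (Nat.eq_dec a b) as [<-|hab].
  + destruct (Nat.eqb_spec a 0); [congruence|].
    assert (j <> k) by congruence.
    assert (L <= m)%nat by nia.
    apply le_INR in H8.
    hedgehog_cases; lra.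
  + assert (h : (m + L + 1 <= l \/ l + L + 1 <= m)%nat).
    { assert (h : (a + 2 <= b \/ b + 2 <= a)%nat) by lia.
      destruct h; [left|right]; nia. }
    destruct h as [h|h]; apply le_INR in h; rewrite !plus_INR in h; simpl in h;
      hedgehog_cases; lra.
Qed.

(** * An ordinal-free form of regular FDC *)

(** [QQ N] may be any family containing the inverse images of the subspaces of
    diameter at most [N]; this leaves freedom in describing those images. *)
Inductive reg : metric_family -> Prop :=
| reg_bounded (XX : metric_family) : bounded XX -> reg XX
| reg_step (XX YY : metric_family) (rho : R -> R) (QQ : nat -> metric_family) :
    finite_asdim YY -> control rho -> (forall N, reg (QQ N)) ->
    (forall X, XX X -> exists (Y : Metric_Space) (f : Base X -> Base Y),
       YY Y /\
       (forall x y, dist Y (f x) (f y) <= rho (dist X x y)) /\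
       (forall N B, diam_le (INR N) B -> QQ N (subspace (fun x => B (f x))))) ->
    reg XX.

(** The recursive occurrence of [R_class] is under an existential quantifier
    and a conjunction, so this induction principle has to be built by hand. *)
Lemma R_class_induction (P : ordinal -> metric_family -> Prop) :
  (forall a XX, ord_is_zero a -> bounded XX -> P a XX) ->
  (forall a XX YY F, ~ ord_is_zero a -> finite_asdim YY ->
     is_family_map XX YY F -> coarse F ->
     (forall BB, is_subfamily BB YY -> bounded (family_of BB) ->
        exists b, ord_lt b a /\ P b (inverse_image F BB)) -> P a XX) ->
  forall a XX, R_class a XX -> P a XX.
Proof.
intros H0 H1; fix IH 3; intros a XX [a' XX' h hb|a' XX' YY F h hY hF hc H].
- now apply H0.
- apply (H1 a' XX' YY F); auto.
  intros BB h1 h2; destruct (H BB h1 h2) as (b & hlt & hR).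
  exists b; split; [exact hlt|exact (IH _ _ hR)].
Qed.

Definition small_subspaces (YY : metric_family) (D : R) : subspaces :=
  fun Y B => YY Y /\ diam_le D B.

Lemma small_subspaces_bounded YY D : bounded (family_of (small_subspaces YY D)).
Proof.
apply bounded_iff; exists D; intros M (Y & B & [_ h] & ->) [x hx] [y hy].
now apply h.
Qed.

Lemma subfamily_small YY BB :
  is_subfamily BB YY -> bounded (family_of BB) ->
  exists N, forall Y B, BB Y B -> small_subspaces YY (INR N) B.
Proof.
intros hs [D hD]%bounded_iff.
destruct (INR_unbounded D) as [N hN]; exists N.
intros Y B hB; split; [now apply (hs Y B)|].
intros x y hx hy.
pose proof (hD (subspace B) (ex_intro _ Y (ex_intro _ B (conj hB eq_refl)))
  (exist _ x hx) (exist _ y hy)) as h.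
change (dist Y x y <= D) in h; lra.
Qed.

Lemma R_class_reg a XX : R_class a XX -> reg XX.
Proof.
intros H; induction H using R_class_induction.
- now apply reg_bounded.
- destruct H2 as (rho & h1 & h2 & h3); destruct H1 as [hF1 hF2].
  apply (reg_step (YY := YY) (rho := rho)
    (QQ := fun N => inverse_image F (small_subspaces YY (INR N)))); auto.
  + split; auto.
  + intros N.
    destruct (H3 (small_subspaces YY (INR N))) as (b & _ & hb); auto.
    * intros Y B [h _]; exact h.
    * apply small_subspaces_bounded.
  + intros X hX; destruct (hF2 X hX) as (Y & f & hf); exists Y, f.
    split; [now apply (hF1 X Y f)|split; [now apply h3|]].
    intros N B hB; exists X, Y, f, B; repeat split; auto; now apply (hF1 X Y f).
Qed.

(** * Countable ordinals *)

Definition ord_zero : ordinal.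
Proof.
refine (@Ordinal Empty_set (fun _ _ => False) _ _ _); intros [].
Defined.

(** The image need not be an initial segment. This is what makes it immediate
    that each [a n] is below [ord_sum a], where it is a middle segment. *)
Definition ord_le (b a : ordinal) : Prop :=
  exists f : b -> a, forall x y, ord_rel x y -> ord_rel (f x) (f y).

Lemma ord_zero_lt (a : ordinal) : ~ ord_is_zero a -> ord_lt ord_zero a.
Proof.
intros h; apply NNPP in h; destruct h as [x].
assert (m : exists t : a, forall z, ~ ord_rel z t).
{ induction (ord_rel_wf x) as [x _ IH].
  destruct (classic (exists z, ord_rel z x)) as [[z hz]|hx].
  - now apply (IH z).
  - exists x; intros z hz; apply hx; eauto. }
destruct m as [t ht].
exists (fun e : ord_zero => match e with end), t; split.
- intros [].
- intros z; split; [intros hz; now apply ht in hz|intros [[] _]].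
Qed.

Definition ord_below (a : ordinal) (t : a) : ordinal.
Proof.
refine (@Ordinal {z : a | ord_rel z t}
  (fun x y => ord_rel (proj1_sig x) (proj1_sig y)) _ _ _).
- intros [x hx]; revert hx.
  induction (ord_rel_wf x) as [x _ IH]; intros hx; constructor.
  intros [y hy] hyx; now apply IH.
- intros x y z; apply ord_rel_trans.
- intros [x hx] [y hy]; simpl.
  destruct (ord_rel_total x y) as [h|[h|h]]; auto.
  right; left; now apply subset_eq_compat.
Defined.

Lemma ord_below_lt (a : ordinal) (t : a) : ord_lt (ord_below t) a.
Proof.
exists (fun z : ord_below t => proj1_sig z), t; split; auto.
intros z; split.
- intros hz; now exists (exist _ z hz).
- intros [[x hx] <-]; exact hx.
Qed.

(** For nonzero [a], isometric maps serve as the coarse map to the family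
    itself; all inverse images are then bounded, hence of class zero. *)
Lemma R_class_bounded (a : ordinal) (XX : metric_family) :
  bounded XX -> R_class a XX.
Proof.
intros hb; destruct (classic (ord_is_zero a)) as [h|h].
- now apply R_class_zero.
- apply (@R_class_pos a XX XX
    (fun X Y f => XX X /\ XX Y /\ forall x y, dist Y (f x) (f y) = dist X x y)); auto.
  + now apply finite_asdim_bounded.
  + split; [tauto|].
    intros X hX; exists X, (fun x => x); auto.
  + exists (fun t => t); repeat split; auto.
    intros X Y f (_ & _ & h') x y; rewrite h'; lra.
  + intros BB _ _; exists ord_zero; split; [now apply ord_zero_lt|].
    apply R_class_zero; [intros [[]]|].
    apply bounded_iff in hb as [D hD]; apply bounded_iff; exists D.
    intros M (X & Y & f & B & (hX & _) & _ & ->) [x hx] [y hy].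
    exact (hD X hX x y).
Qed.

(** An order embedding of [b] in [a] takes the segment of [b] below a point [t] into the
    segment of [a] below the image of [t], so the induction hypothesis applies
    to smaller ordinals although initial segments are not preserved. *)
Lemma R_class_mono (b : ordinal) (XX : metric_family) :
  R_class b XX -> forall (a : ordinal) (XX' : metric_family),
  ord_le b a -> (forall X, XX' X -> XX X) -> R_class a XX'.
Proof.
intros H; induction H as [b XX h hb|b XX YY F hb hY [hF1 hF2] hc IH]
  using R_class_induction; intros a XX' [g hg] hs.
- apply R_class_bounded; apply bounded_iff in hb as [D hD].
  apply bounded_iff; exists D; auto.
- apply (@R_class_pos a XX' YY (fun X Y f => XX' X /\ F X Y f)); auto.
  + intros ha; apply hb; intros [x]; apply ha; constructor; exact (g x).
  + split.
    * intros X Y f [hX hf]; split; [auto|now apply (hF1 X Y f)].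
    * intros X hX; destruct (hF2 X (hs X hX)) as (Y & f & hf); exists Y, f; auto.
  + destruct hc as (rho & h1 & h2 & h3); exists rho; repeat split; auto.
    intros X Y f [_ hf]; now apply h3.
  + intros BB h1 h2; destruct (IH BB h1 h2) as (b' & (f & t & hf & ht) & IH').
    exists (ord_below (g t)); split; [apply ord_below_lt|].
    apply IH'.
    * unshelve eexists.
      { intros x; exists (g (f x)); apply hg, ht; eauto. }
      intros x y hxy; simpl; auto.
    * intros M (X & Y & f' & B & [_ hf'] & hB & ->).
      exists X, Y, f', B; auto.
Qed.

Definition ord_succ (a : ordinal) : ordinal.
Proof.
refine (@Ordinal (option a)
  (fun x y => match x, y with
              | Some x, Some y => ord_rel x y
              | Some _, None => True
              | None, _ => False
              end) _ _ _).
- assert (h : forall x : a, Acc (fun x y : option a => match x, y with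
              | Some x, Some y => ord_rel x y
              | Some _, None => True
              | None, _ => False
              end) (Some x)).
  { intros x; induction (ord_rel_wf x) as [x _ IH].
    constructor; intros [y|] hy; [now apply IH|contradiction]. }
  intros [x|]; [apply h|].
  constructor; intros [y|] hy; [apply h|contradiction].
- intros [x|] [y|] [z|]; try tauto; apply ord_rel_trans.
- intros [x|] [y|]; auto.
  destruct (ord_rel_total x y) as [h|[->|h]]; auto.
Defined.

Lemma ord_lt_succ (a : ordinal) : ord_lt a (ord_succ a).
Proof.
exists (fun x : a => Some x : ord_succ a), (None : ord_succ a); split; auto.
intros [x|]; simpl; split; try tauto; [eauto|intros [x hx]; discriminate].
Qed.

Definition ord_sum (a : nat -> ordinal) : ordinal.
Proof.
refine (@Ordinal {n : nat & a n}
  (lexprod nat (fun n => a n) lt (fun n => @ord_rel (a n))) _ _ _).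
- apply wf_lexprod; [apply lt_wf|intros n; apply ord_rel_wf].
- intros x y z hxy hyz.
  destruct hxy as [n m x y hnm|n x y hxy].
  + inversion hyz; subst; left; lia.
  + remember (existT _ n y) as p eqn:ep; destruct hyz as [n' m y' z hnm|n' y' z hyz].
    * apply (f_equal (@projT1 _ _)) in ep as en; simpl in en; subst n'; now left.
    * apply (f_equal (@projT1 _ _)) in ep as en; simpl in en; subst n'.
      apply inj_pair2 in ep; subst y'.
      right; now apply (ord_rel_trans hxy).
- intros [n x] [m y].
  destruct (lt_eq_lt_dec n m) as [[h|<-]|h].
  + left; now left.
  + destruct (ord_rel_total x y) as [h|[->|h]]; auto.
    * left; now right.
    * right; right; now right.
  + right; right; now left.
Defined.

Lemma ord_le_sum (a : nat -> ordinal) n : ord_le (a n) (ord_sum a).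
Proof.
exists (fun x => existT _ n x : ord_sum a); intros x y h; now right.
Qed.

Lemma ord_countable_succ_sum (a : nat -> ordinal) :
  (forall n, ord_countable (a n)) -> ord_countable (ord_succ (ord_sum a)).
Proof.
intros H.
pose (g n := proj1_sig (constructive_indefinite_description _ (H n))).
assert (hg : forall n x y, g n x = g n y -> x = y).
{ intros n; apply (proj2_sig (constructive_indefinite_description _ (H n))). }
exists (fun x => match x with
  | Some (existT _ n x) => S (to_nat (n, g n x))
  | None => O
  end).
intros [[n x]|] [[m y]|]; try discriminate; auto.
intros e; apply Nat.succ_inj, to_nat_inj in e.
injection e as <- e2; apply hg in e2; now subst.
Qed.

(** All inverse images are placed in the class of one ordinal, the sum over [N]
    of those obtained for [QQ N]; its successor bounds it strictly. *)
Lemma reg_regular_FDC XX : reg XX -> regular_FDC XX.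
Proof.
induction 1 as [XX hb|XX YY rho QQ hY [hr1 hr2] _ IH H].
- exists ord_zero; split; [exists (fun _ => O); intros []|now apply R_class_bounded].
- apply choice_fun in IH as [a ha].
  exists (ord_succ (ord_sum a)); split.
  { apply ord_countable_succ_sum; intros n; apply ha. }
  apply (@R_class_pos _ XX YY (fun X Y f => XX X /\ YY Y /\
       (forall x y, dist Y (f x) (f y) <= rho (dist X x y)) /\
       (forall N B, diam_le (INR N) B -> QQ N (subspace (fun x => B (f x)))))); auto.
  + intros h; apply h; constructor; exact None.
  + split; [tauto|].
    intros X hX; destruct (H X hX) as (Y & f & h); exists Y, f; tauto.
  + exists rho; repeat split; auto; intros X Y f h; apply h.
  + intros BB h1 h2; destruct (subfamily_small h1 h2) as [N hN].
    exists (ord_sum a); split; [apply ord_lt_succ|].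
    apply (R_class_mono (proj2 (ha N)) (ord_le_sum a N)).
    intros M (X & Y & f & B & (hX & hY' & hf & hQ) & hB & ->).
    now apply hQ, hN.
Qed.

Lemma regular_FDC_reg XX : regular_FDC XX <-> reg XX.
Proof.
split; [intros (a & _ & h); exact (R_class_reg h)|apply reg_regular_FDC].
Qed.

(** * Rough embeddings and amalgamation *)

(** Rough isometric embeddings cover the two kinds of comparison needed below:
    isometric identifications ([C = 0]) and retractions of neighborhoods. *)
Definition rough_embedding (C : R) (M X : Metric_Space) (g : Base M -> Base X) : Prop :=
  forall m m', dist X (g m) (g m') <= dist M m m' + C /\
               dist M m m' <= dist X (g m) (g m') + C.

Definition roughly_in (C : R) (XX : metric_family) (M : Metric_Space) : Prop :=
  exists X, XX X /\ exists g : Base M -> Base X, rough_embedding C g.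

Lemma roughly_in_self (XX : metric_family) X : XX X -> roughly_in 0 XX X.
Proof.
intros hX; exists X; split; auto; exists (fun x => x); intros x y; lra.
Qed.

Lemma subspace_roughly_in (XX : metric_family) (X : Metric_Space)
    (A B : Base X -> Prop) :
  (forall x, A x -> B x) -> XX (subspace B) -> roughly_in 0 XX (subspace A).
Proof.
intros hAB hB; exists (subspace B); split; auto.
exists (fun a : Base (subspace A) =>
  exist B (proj1_sig a) (hAB _ (proj2_sig a)) : Base (subspace B)).
intros x y; simpl; unfold subspace_dist; simpl; lra.
Qed.

(** Compose the coarse maps with the rough embeddings; preimages under the
    composites again embed roughly in preimages. *)
Lemma reg_rough (C : R) (XX : metric_family) :
  0 <= C -> reg XX -> reg (roughly_in C XX).
Proof.
intros hC; induction 1 as [XX hb|XX YY rho QQ hY [hr1 hr2] _ IH H].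
- apply reg_bounded; apply bounded_iff in hb as [D hD]; apply bounded_iff.
  exists (D + C); intros M (X & hX & g & hg) x y.
  destruct (hg x y) as [_ h]; specialize (hD X hX (g x) (g y)); lra.
- apply (reg_step (YY := YY) (rho := fun t => rho (t + C))
    (QQ := fun N => roughly_in C (QQ N))); auto.
  + split; intros; [apply hr1|apply hr2]; lra.
  + intros M (X & hX & g & hg); destruct (H X hX) as (Y & f & hY' & hf & hQ).
    exists Y, (fun m => f (g m)); split; [auto|split].
    * intros x y; eapply Rle_trans; [apply hf|].
      apply hr2; [apply dist_nonneg|apply hg].
    * intros N B hB; exists (subspace (fun x => B (f x))); split; [auto|].
      exists (fun m : Base (subspace (fun m => B (f (g m)))) =>
        exist (fun x => B (f x)) (g (proj1_sig m)) (proj2_sig m)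
        : Base (subspace (fun x => B (f x)))).
      intros x y; exact (hg (proj1_sig x) (proj1_sig y)).
Qed.

Lemma reg_mono (XX XX' : metric_family) :
  reg XX -> (forall X, XX' X -> XX X) -> reg XX'.
Proof.
intros [XX0 hb|XX0 YY rho QQ hY hr hQ H] hs.
- apply reg_bounded; apply bounded_iff in hb as [D hD]; apply bounded_iff.
  exists D; auto.
- apply (reg_step hY hr hQ); auto.
Qed.

Lemma reg_roughly_in (C : R) (XX XX' : metric_family) :
  0 <= C -> reg XX -> (forall M, XX' M -> roughly_in C XX M) -> reg XX'.
Proof. intros hC h; apply reg_mono, reg_rough; auto. Qed.

Definition diameter_le (D : R) : metric_family :=
  fun M => forall x y, dist M x y <= D.

Lemma bounded_diameter_le D : bounded (diameter_le D).
Proof. apply bounded_iff; exists D; auto. Qed.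

Lemma control_add (rho1 rho2 : R -> R) :
  control rho1 -> control rho2 -> control (fun t => rho1 t + rho2 t).
Proof.
intros [p1 m1] [p2 m2]; split.
- intros t ht; specialize (p1 t ht); specialize (p2 t ht); lra.
- intros s t hs hst; specialize (m1 s t hs hst); specialize (m2 s t hs hst); lra.
Qed.

Lemma control_affine (a b : R) : 0 <= a -> 0 <= b -> control (fun t => a * t + b).
Proof. intros ha hb; split; intros; nra. Qed.

(** The bounded part is mapped to itself by the identity. Allowing all spaces
    of diameter at most [D] makes this part stable under passing to inverse
    images, as the induction requires. *)
Lemma reg_union_diameter_le (D : R) (XX : metric_family) :
  reg XX -> reg (family_union (diameter_le D) XX).
Proof.
induction 1 as [XX hb|XX YY rho QQ hY hr _ IH H].
- apply reg_bounded; apply bounded_iff in hb as [E hE]; apply bounded_iff.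
  exists (Rmax D E); intros X [hX|hX] x y.
  + eapply Rle_trans; [apply hX|apply Rmax_l].
  + eapply Rle_trans; [apply (hE X hX)|apply Rmax_r].
- apply (reg_step (YY := family_union (diameter_le D) YY)
    (rho := fun t => (1 * t + 0) + rho t)
    (QQ := fun N => family_union (diameter_le D) (QQ N))); auto.
  + apply finite_asdim_union; auto.
    apply finite_asdim_bounded, bounded_diameter_le.
  + apply control_add; auto; apply control_affine; lra.
  + destruct hr as [hr _]; intros X [hX|hX].
    * exists X, (fun x => x); split; [now left|split].
      -- intros x y; specialize (hr _ (dist_nonneg x y)); lra.
      -- intros N B _; left; intros [x hx] [y hy]; exact (hX x y).
    * destruct (H X hX) as (Y & f & hY' & hf & hQ); exists Y, f.
      split; [now right|split].
      -- intros x y; specialize (hf x y); pose proof (dist_nonneg x y); lra.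
      -- intros N B hB; right; auto.
Qed.

Lemma reg_union (XX1 XX2 : metric_family) :
  reg XX1 -> reg XX2 -> reg (family_union XX1 XX2).
Proof.
assert (hbd : forall XX XX', bounded XX -> reg XX' -> reg (family_union XX XX')).
{ intros XX XX' [D hD]%bounded_iff h.
  apply (reg_mono (reg_union_diameter_le D h)).
  intros X [hX|hX]; [left; intros x y; now apply hD|now right]. }
intros H1; revert XX2.
induction H1 as [XX1 hb|XX1 YY1 rho1 QQ1 hY1 hr1 hQ1 IH H1]; intros XX2 H2.
- now apply hbd.
- destruct H2 as [XX2 hb|XX2 YY2 rho2 QQ2 hY2 hr2 hQ2 H2].
  + apply (@reg_mono (family_union XX2 XX1)).
    * apply hbd; auto; exact (reg_step hY1 hr1 hQ1 H1).
    * intros X [hX|hX]; [now right|now left].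
  + apply (reg_step (YY := family_union YY1 YY2) (rho := fun t => rho1 t + rho2 t)
      (QQ := fun N => family_union (QQ1 N) (QQ2 N))); auto.
    * now apply finite_asdim_union.
    * now apply control_add.
    * intros X [hX|hX].
      -- destruct (H1 X hX) as (Y & f & hY & hf & hQ); exists Y, f.
         split; [now left|split].
         ++ intros x y; specialize (hf x y).
            pose proof (proj1 hr2 _ (dist_nonneg x y)); lra.
         ++ intros N B hB; left; auto.
      -- destruct (H2 X hX) as (Y & f & hY & hf & hQ); exists Y, f.
         split; [now right|split].
         ++ intros x y; specialize (hf x y).
            pose proof (proj1 hr1 _ (dist_nonneg x y)); lra.
         ++ intros N B hB; right; auto.
Qed.

Lemma reg_amalgamation (n : nat) (XXs : nat -> metric_family) :
  (forall i, (1 <= i <= n)%nat -> reg (XXs i)) ->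
  reg (fun X => exists i, (1 <= i <= n)%nat /\ XXs i X).
Proof.
induction n as [|n IH]; intros H.
- apply reg_bounded, bounded_iff; exists 0; intros X (i & hi & _); lia.
- apply (@reg_mono (family_union (XXs (S n))
     (fun X => exists i, (1 <= i <= n)%nat /\ XXs i X))).
  + apply reg_union; [apply H; lia|apply IH; intros; apply H; lia].
  + intros X (i & hi & hX).
    destruct (Nat.eq_dec i (S n)) as [->|h]; [now left|].
    right; exists i; split; auto; lia.
Qed.

(** * Unions *)

(** The labels are the pieces of a union rather than their indices, so that a
    family of spaces can be treated with labels in one uniform type. Pieces with
    different labels are only required to be apart outside [V n]: inside it they
    may come close or overlap. *)
Record filtration (X : Metric_Space) (V : nat -> Base X -> Prop)
    (lab : Base X -> Base X -> Prop) : Prop := {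
  filtration_thicken : forall n k x y,
    V n x -> dist X x y <= INR k -> V (n + k)%nat y;
  filtration_self : forall x, lab x x;
  filtration_disjoint : forall n x y,
    dist X x y <= INR n -> V n x \/ V n y \/ lab x = lab y
}.

Lemma height_exists (P : nat -> Prop) :
  exists h, (forall n, P n -> (h <= n)%nat) /\ (P h \/ h = O /\ forall n, ~ P n).
Proof.
destruct (classic (exists n, P n)) as [[n hn]|H].
- induction n as [n IH] using (well_founded_ind lt_wf).
  destruct (classic (exists m, (m < n)%nat /\ P m)) as [(m & hm & h)|H].
  + now apply (IH m).
  + exists n; split; auto.
    intros m hm; destruct (Nat.le_gt_cases n m); auto; exfalso; eauto.
- exists O; split; [intros; lia|right; split; auto; intros n hn; eauto].
Qed.

(** The point [x] goes to the spoke [lab x], at the height of [x], that is, the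
    least [n] with [V n x]. In a space where all [V n] are empty, all labels
    agree and height 0 is as good as any. *)
Lemma filtration_map (X : Metric_Space) V lab :
  @filtration X V lab ->
  exists f : Base X -> Base (hedgehog (Base X -> Prop)),
    (forall x y, dist _ (f x) (f y) <= 3 * dist X x y + 4) /\
    (forall N B, diam_le (INR N) B ->
       (forall x, B (f x) -> V N x) \/ exists x0, forall x, B (f x) -> lab x0 x).
Proof.
intros [thick self disj].
destruct (choice_fun (fun x => height_exists (fun n => V n x))) as [H hH].
assert (mono : forall n m x, V n x -> (n <= m)%nat -> V m x).
{ intros n m x hx hnm; replace m with (n + (m - n))%nat by lia.
  apply (thick _ _ x); auto; rewrite dist_self; apply pos_INR. }
assert (Hthick : forall n x y, dist X x y <= INR n -> (H y <= H x + n)%nat).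
{ intros n x y hxy; destruct (hH x) as [_ [hx|[_ hx]]].
  - apply hH; eapply thick; eauto.
  - destruct (hH y) as [_ [hy|[hy _]]]; [|lia].
    exfalso; apply (hx (H y + n)%nat), (thick _ _ y); auto; now rewrite dist_sym. }
exists (fun x => (lab x, H x)); split.
- intros x y; destruct (nat_ceil (dist_nonneg x y)) as (n & hn1 & hn2).
  assert (hn3 : dist X y x <= INR n) by now rewrite dist_sym.
  pose proof (Hthick n x y hn1) as h1; pose proof (Hthick n y x hn3) as h2.
  pose proof (dist_nonneg x y).
  (* With different labels one of the points has height at most n, hence the
     other one has height at most 2n. *)
  assert (hl : lab x = lab y \/ (H x + H y <= 3 * n)%nat).
  { destruct (disj n x y hn1) as [h|[h|h]]; auto; apply hH in h; right; lia. }
  apply le_INR in h1, h2; rewrite plus_INR in h1, h2.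
  destruct hl as [hl|hl].
  + hedgehog_cases; lra.
  + apply le_INR in hl; rewrite plus_INR, mult_INR in hl; simpl in hl.
    hedgehog_cases; lra.
- intros N B hB.
  destruct (classic (exists x, B (lab x, H x) /\ ~ V N x)) as [(x0 & hx0 & hV)|hV].
  + (* A point of the preimage on another spoke would bound the height of x0 by
       N, whereas x0 lies outside V N. *)
    right; exists x0; intros x hx.
    destruct (classic (lab x0 = lab x)) as [->|hl]; auto.
    destruct (nat_ceil (dist_nonneg x0 x)) as (n & hn & _).
    exfalso; apply hV.
    (* Different labels exclude the case where the height 0 is a default. *)
    assert (h0 : exists m, V m x0).
    { destruct (disj n x0 x hn) as [h|[h|h]]; [eauto| |contradiction].
      exists (n + n)%nat; apply (thick _ _ x); auto; now rewrite dist_sym. }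
    pose proof (hB _ _ hx0 hx) as h.
    assert (hN : (H x0 <= N)%nat).
    { apply INR_le; revert h; simpl; pose proof (pos_INR (H x)).
      hedgehog_cases; lra. }
    destruct (hH x0) as [_ [h1|[_ h1]]]; [now apply (mono (H x0))|].
    destruct h0 as [m hm]; now apply h1 in hm.
  + left; intros x hx; apply NNPP; intros h; eauto.
Qed.

Lemma reg_of_filtrations (XX PP : metric_family) (QQ : nat -> metric_family) :
  reg PP -> (forall n, reg (QQ n)) ->
  (forall X, XX X -> exists V lab, @filtration X V lab /\
     (forall n, QQ n (subspace (V n))) /\ (forall x, PP (subspace (lab x)))) ->
  reg XX.
Proof.
intros hP hQ H.
apply (reg_step (rho := fun t => 3 * t + 4)
  (QQ := fun N => roughly_in 0 (family_union PP (QQ N))) finite_asdim_hedgehog).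
- apply control_affine; lra.
- intros N; apply reg_rough; [lra|]; now apply reg_union.
- intros X hX; destruct (H X hX) as (V & lab & hf & hV & hl).
  destruct (filtration_map hf) as (f & f1 & f2).
  exists (hedgehog (Base X -> Prop)), f.
  split; [now eexists|split; auto].
  intros N B hB; destruct (f2 N B hB) as [h|[x0 h]].
  + apply subspace_roughly_in with (1 := h); right; auto.
  + apply subspace_roughly_in with (1 := h); left; auto.
Qed.

Definition neighborhood (X : Metric_Space) (n : nat) (A : Base X -> Prop) : Base X -> Prop :=
  fun x => exists a, A a /\ dist X a x <= INR n.

Lemma neighborhood_thicken (X : Metric_Space) n k (A : Base X -> Prop) x y :
  neighborhood n A x -> dist X x y <= INR k -> neighborhood (n + k) A y.
Proof.
intros (a & ha & hx) hxy; exists a; split; auto.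
rewrite plus_INR; pose proof (dist_tri X a y x); lra.
Qed.

Lemma neighborhood_self (X : Metric_Space) n (A : Base X -> Prop) x :
  A x -> neighborhood n A x.
Proof. intros h; exists x; rewrite dist_self; split; auto; apply pos_INR. Qed.

(** Send each point of the neighborhood to a point of [A] within [n] of it. *)
Lemma neighborhood_roughly_in (X : Metric_Space) n (A : Base X -> Prop) :
  exists g : Base (subspace (neighborhood n A)) -> Base (subspace A),
    rough_embedding (2 * INR n) g.
Proof.
assert (H : forall x : Base (subspace (neighborhood n A)),
  exists a : Base (subspace A), dist X (proj1_sig a) (proj1_sig x) <= INR n).
{ intros [x (a & ha & hx)]; now exists (exist _ a ha). }
apply choice_fun in H as [g hg]; exists g; intros x y.
pose proof (hg x); pose proof (hg y); simpl; unfold subspace_dist.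
set (a := proj1_sig (g x)) in *; set (b := proj1_sig (g y)) in *.
destruct x as [x hx], y as [y hy]; simpl in *.
pose proof (dist_tri X a b x); pose proof (dist_tri X x b y).
pose proof (dist_tri X x y a); pose proof (dist_tri X a y b).
rewrite (dist_sym X y b), (dist_sym X x a) in *; lra.
Qed.

Lemma reg_neighborhood (n : nat) (XX : metric_family) :
  reg XX ->
  reg (fun M => exists (X : Metric_Space) (A : Base X -> Prop),
     roughly_in 0 XX (subspace A) /\ M = subspace (neighborhood n A)).
Proof.
intros h; apply (reg_roughly_in (C := 2 * INR n) (XX := roughly_in 0 XX)).
- pose proof (pos_INR n); lra.
- apply reg_rough; auto; lra.
- intros M (X & A & hA & ->); exists (subspace A); split; auto.
  apply neighborhood_roughly_in.
Qed.

(** Filter by the neighborhoods of [A]; outside [A] the only label is [B]. *)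
Lemma reg_binary_union (XX XX1 XX2 : metric_family) :
  reg XX1 -> reg XX2 ->
  (forall X, XX X -> exists A B : Base X -> Prop,
     roughly_in 0 XX1 (subspace A) /\ roughly_in 0 XX2 (subspace B) /\
     forall x, A x \/ B x) ->
  reg XX.
Proof.
intros h1 h2 H.
apply (@reg_of_filtrations XX (roughly_in 0 (family_union XX1 XX2))
  (fun n M => exists (X : Metric_Space) (A : Base X -> Prop),
     roughly_in 0 XX1 (subspace A) /\ M = subspace (neighborhood n A))).
- apply reg_rough; [lra|now apply reg_union].
- intros n; now apply reg_neighborhood.
- intros X hX; destruct (H X hX) as (A & B & hA & hB & hAB).
  exists (fun n => neighborhood n A),
    (fun x => if excluded_middle_informative (A x) then A else B).
  split; [split|split].
  + intros n k x y; apply neighborhood_thicken.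
  + intros x; destruct excluded_middle_informative; auto.
    destruct (hAB x); tauto.
  + intros n x y _.
    destruct excluded_middle_informative; [left; now apply neighborhood_self|].
    destruct excluded_middle_informative; auto.
    right; left; now apply neighborhood_self.
  + intros n; exists X, A; auto.
  + intros x; destruct excluded_middle_informative.
    * destruct hA as (M & hM & g); exists M; split; auto; now left.
    * destruct hB as (M & hM & g); exists M; split; auto; now right.
Qed.

Definition covered_by (n : nat) (XXs : nat -> metric_family) : metric_family :=
  fun X => exists A : nat -> Base X -> Prop,
    (forall i, (1 <= i <= n)%nat -> roughly_in 0 (XXs i) (subspace (A i))) /\
    (forall x, exists i, (1 <= i <= n)%nat /\ A i x).

Lemma reg_covered_by (n : nat) (XXs : nat -> metric_family) :
  (forall i, (1 <= i <= n)%nat -> reg (XXs i)) -> reg (covered_by n XXs).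
Proof.
induction n as [|n IH]; intros H.
- apply reg_bounded, bounded_iff; exists 0; intros X (A & _ & cov) x.
  destruct (cov x) as (i & hi & _); lia.
- apply (@reg_binary_union _ (covered_by n XXs) (XXs (S n))).
  + apply IH; intros; apply H; lia.
  + apply H; lia.
  + intros X (A & hA & cov).
    exists (fun x => exists i, (1 <= i <= n)%nat /\ A i x), (A (S n)).
    split; [|split].
    * apply roughly_in_self.
      exists (fun i x => A i (proj1_sig x)); split.
      -- intros i hi; destruct (hA i) as (M & hM & g & hg); [lia|].
         exists M; split; auto.
         exists (fun y => g (exist (A i) (proj1_sig (proj1_sig y)) (proj2_sig y))).
         intros y y'; exact (hg (exist (A i) (proj1_sig (proj1_sig y)) (proj2_sig y))
           (exist (A i) (proj1_sig (proj1_sig y')) (proj2_sig y'))).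
      -- intros [x hx]; exact hx.
    * apply hA; lia.
    * intros x; destruct (cov x) as (i & hi & hx).
      destruct (Nat.eq_dec i (S n)) as [->|h]; auto.
      left; exists i; split; auto; lia.
Qed.

Lemma is_subspace_roughly_in (XX : metric_family) (X : Metric_Space)
    (A : Base X -> Prop) :
  (exists M, XX M /\ is_subspace M A) -> roughly_in 0 XX (subspace A).
Proof.
intros (M & hM & e & he & hA); exists M; split; auto.
assert (H : forall x : Base (subspace A), exists m, e m = proj1_sig x).
{ intros [x hx]; now apply hA. }
apply choice_fun in H as [g hg]; exists g; intros x y.
rewrite <- he, !hg; simpl; unfold subspace_dist; lra.
Qed.

(** Filter by the neighborhoods of finite unions of the exceptional sets, which
    are increasing, and label each point by a piece containing it. *)
Theorem reg_union_permanence : union_permanence reg.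
Proof.
intros I X J U cov hU hY.
assert (H : forall m, exists Y : forall i, Base (X i) -> Prop,
   reg (range (fun i => subspace (Y i))) /\
   (forall i, r_disjoint (INR m + 1) (fun (j : J i) x => U i j x /\ ~ Y i x))).
{ intros m; apply hY; pose proof (pos_INR m); lra. }
apply choice_fun in H as [Y hYm].
(* The bound S n, rather than n, gives a point outside W 0 something to avoid:
   it lies outside Y 1, and points at distance 0 can be compared there. *)
pose (W n i x := exists m, (1 <= m <= S n)%nat /\ Y m i x).
apply (@reg_of_filtrations _ (fun M => exists i j, M = subspace (U i j))
  (fun n M => exists (Z : Metric_Space) (A : Base Z -> Prop),
     roughly_in 0 (covered_by (S n) (fun m => range (fun i => subspace (Y m i))))
       (subspace A) /\ M = subspace (neighborhood n A))); auto.
- intros n; apply reg_neighborhood, reg_covered_by; intros m _; apply hYm.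
- intros Z [i ->].
  destruct (choice_fun (cov i)) as [lab hlab].
  exists (fun n => neighborhood n (W n i)), (fun x => U i (lab x)).
  split; [split|split].
  + intros n k x y hx hxy.
    destruct (neighborhood_thicken hx hxy) as (a & (m & hm & ha) & hay).
    exists a; split; auto; exists m; split; auto; lia.
  + exact hlab.
  + intros n x y hxy.
    destruct (classic (W n i x)) as [hx|hx]; [left; now apply neighborhood_self|].
    destruct (classic (W n i y)) as [hy|hy]; [right; left; now apply neighborhood_self|].
    right; right; destruct (classic (lab x = lab y)) as [->|hl]; auto.
    destruct (hYm (S n)) as [_ hd].
    assert (hd' : dist (X i) x y > INR (S n) + 1); [|rewrite S_INR in hd'; lra].
    apply (hd i (lab x) (lab y)); auto; split; auto; intros h.
    * apply hx; exists (S n); split; auto; lia.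
    * apply hy; exists (S n); split; auto; lia.
  + intros n; exists (X i), (W n i); split; auto.
    apply roughly_in_self.
    exists (fun m x => Y m i (proj1_sig x)); split.
    * intros m hm; exists (subspace (Y m i)); split; [now exists i|].
      exists (fun y : Base (subspace (fun z : Base (subspace (W n i)) => Y m i (proj1_sig z))) =>
        exist (Y m i)
        (proj1_sig (proj1_sig y)) (proj2_sig y) : Base (subspace (Y m i))).
      intros y y'; simpl; unfold subspace_dist; simpl.
      unfold subspace_dist; simpl; lra.
    * intros [x hx]; exact hx.
  + intros x; eauto.
Qed.

(** * Limits *)

(** The distance is the least [n] such that the points are [P n]-related;
    transitivity of each [P n] is the ultrametric inequality. *)
Lemma filtered_ultrametric (T : Type) (P : nat -> T -> T -> Prop) :
  (forall x y, P O x y <-> x = y) ->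
  (forall n m x y, (n <= m)%nat -> P n x y -> P m x y) ->
  (forall n x y, P n x y -> P n y x) ->
  (forall n x y z, P n x y -> P n y z -> P n x z) ->
  (forall x y, exists n, P n x y) ->
  exists d : T -> T -> R,
    (forall n x y, d x y <= INR n <-> P n x y) /\
    (forall x y, d x y >= 0) /\ (forall x y, d x y = d y x) /\
    (forall x y, d x y = 0 <-> x = y) /\
    (forall x y z, d x z <= Rmax (d x y) (d y z)).
Proof.
intros P0 mono sym trans ex.
assert (H : forall p : T * T, exists h, forall n,
  (h <= n)%nat <-> P n (fst p) (snd p)).
{ intros [x y]; destruct (height_exists (fun n => P n x y)) as (h & h1 & h2).
  exists h; intros n; split; auto.
  destruct h2 as [h2|[_ h2]]; [simpl; eauto|].
  destruct (ex x y) as [m hm]; now apply h2 in hm. }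
apply choice_fun in H as [h hh].
assert (hP : forall n x y, (h (x, y) <= n)%nat <-> P n x y).
{ intros n x y; apply (hh (x, y)). }
exists (fun x y => INR (h (x, y))).
split; [|split; [|split; [|split]]].
- intros n x y; rewrite <- hP; split; [apply INR_le|apply le_INR].
- intros x y; apply Rle_ge, pos_INR.
- intros x y; f_equal; apply Nat.le_antisymm; apply hP, sym, hP; auto.
- intros x y; rewrite <- P0, <- hP; split; intros e.
  + apply INR_le; rewrite e; simpl; lra.
  + replace (h (x, y)) with O by lia; auto.
- intros x y z.
  assert (e : (h (x, z) <= Nat.max (h (x, y)) (h (y, z)))%nat).
  { apply hP, (trans _ _ y); apply hP; lia. }
  destruct (Nat.max_spec (h (x, y)) (h (y, z))) as [[_ e']|[_ e']];
    rewrite e' in e; apply le_INR in e.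
  + eapply Rle_trans; [exact e|apply Rmax_r].
  + eapply Rle_trans; [exact e|apply Rmax_l].
Qed.

(** The pieces of different scales are unrelated, so points are compared at all
    scales from [n] on; this makes the relations increasing in [n]. *)
Lemma disjoint_pieces_ultrametric (X : Metric_Space) (J : nat -> Type)
    (Y : forall n, J n -> Base X -> Prop) :
  (forall n x, exists j, Y n j x) ->
  (forall n, r_disjoint (INR n + 1) (Y n)) ->
  exists (Z : Metric_Space) (f : Base X -> Base Z),
    is_ultrametric Z /\
    (forall x y, dist Z (f x) (f y) <= 1 * dist X x y + 2) /\
    (forall n x y, dist Z (f x) (f y) <= INR n -> forall j, Y n j x -> Y n j y).
Proof.
intros cov disj.
pose (same n x y := exists j, Y n j x /\ Y n j y).
assert (uniq : forall n j k x, Y n j x -> Y n k x -> j = k).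
{ intros n j k x hj hk; apply NNPP; intros h.
  pose proof (disj n j k h x x hj hk) as e; rewrite dist_self in e.
  pose proof (pos_INR n); lra. }
(* Equality is inserted as stage 0, since a metric must separate points. *)
pose (P n := match n with
  | O => fun x y : Base X => x = y
  | S n => fun x y => forall m, (n <= m)%nat -> same m x y
  end).
assert (close : forall n x y, dist X x y <= INR n -> P (S n) x y).
{ intros n x y hxy m hm.
  destruct (cov m x) as [j hj], (cov m y) as [k hk].
  destruct (classic (j = k)) as [<-|h]; [now exists j|].
  pose proof (disj m j k h x y hj hk); apply le_INR in hm; lra. }
destruct (@filtered_ultrametric (Base X) P) as (d & dP & d1 & d2 & d3 & d4).
- intros x y; simpl; tauto.
- intros [|n] [|m] x y hnm; simpl; auto; [|lia|].
  + intros <- k _; destruct (cov k x) as [j hj]; now exists j.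
  + intros h k hk; apply h; lia.
- intros [|n] x y; simpl; auto.
  intros h m hm; destruct (h m hm) as (j & hx & hy); now exists j.
- intros [|n] x y z; simpl; [congruence|].
  intros h1 h2 m hm; destruct (h1 m hm) as (j & hx & hy), (h2 m hm) as (k & hy' & hz).
  rewrite (uniq _ _ _ _ hy' hy) in hz; now exists j.
- intros x y; destruct (nat_ceil (dist_nonneg x y)) as (n & hn & _).
  exists (S n); now apply close.
- assert (d5 : forall x y z, d x y <= d x z + d z y).
  { intros x y z; eapply Rle_trans; [apply (d4 x z y)|].
    pose proof (d1 x z); pose proof (d1 z y); apply Rmax_lub; lra. }
  exists {| Base := Base X; dist := d; dist_pos := d1; dist_sym := d2;
            dist_refl := d3; dist_tri := d5 |}, (fun x => x); simpl.
  split; [exact d4|split].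
  + intros x y; destruct (nat_ceil (dist_nonneg x y)) as (n & hn & hn').
    pose proof (proj2 (dP (S n) x y) (close n x y hn)) as h.
    rewrite S_INR in h; lra.
  + intros n x y h j hj.
    assert (h' : P (S n) x y) by (apply dP; rewrite S_INR; lra).
    destruct (h' n (Nat.le_refl n)) as (k & hx & hy).
    now rewrite (uniq _ _ _ _ hj hx).
Qed.

Theorem reg_limit_permanence : limit_permanence reg.
Proof.
intros I X H.
assert (H' : forall n, exists p : {J : Type & forall i, J -> Base (X i) -> Prop},
  (forall i, (forall x, exists j, projT2 p i j x) /\ r_disjoint (INR n + 1) (projT2 p i)) /\
  reg (fun M => exists i j, M = subspace (projT2 p i j))).
{ intros n; destruct (H (INR n + 1)) as (J & Y & h).
  - pose proof (pos_INR n); lra.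
  - now exists (existT (fun J => forall i, J -> Base (X i) -> Prop) J Y). }
apply choice_fun in H' as [p hp].
apply (reg_step (rho := fun t => 1 * t + 2)
  (* The summand [diameter_le 0] is for empty preimages: an empty X i may have
     no pieces at all. *)
  (QQ := fun N => roughly_in 0 (family_union (diameter_le 0)
     (fun M => exists i j, M = subspace (projT2 (p N) i j)))) finite_asdim_ultrametric).
- apply control_affine; lra.
- intros N; apply reg_rough; [lra|]; apply reg_union_diameter_le, hp.
- intros M [i ->].
  destruct (@disjoint_pieces_ultrametric (X i) (fun n => projT1 (p n))
    (fun n => projT2 (p n) i)) as (Z & f & hZ & f1 & f2).
  + intros n; now apply (proj1 (hp n) i).
  + intros n; now apply (proj1 (hp n) i).
  + exists Z, f; split; [exact hZ|split; [exact f1|]].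
    intros N B hB; destruct (classic (exists x, B (f x))) as [[x hx]|h].
    * destruct (proj1 (proj1 (hp N) i) x) as [j hj].
      apply (@subspace_roughly_in _ _ _ (projT2 (p N) i j)).
      -- intros y hy; apply (f2 N x y); auto.
      -- right; eauto.
    * apply roughly_in_self; left; intros [x hx]; exfalso; eauto.
Qed.

(** * Permanence of regular finite decomposition complexity *)

Theorem corollary5p13 :
  finite_amalgamation_permanence regular_FDC /\
  finite_union_permanence regular_FDC /\
  union_permanence regular_FDC /\
  limit_permanence regular_FDC.
Proof.
split; [|split; [|split]].
- intros n XXs XX hXs hX; apply regular_FDC_reg.
  apply (@reg_mono (fun X => exists i, (1 <= i <= n)%nat /\ XXs i X)).
  + apply reg_amalgamation; intros i hi; now apply regular_FDC_reg, hXs.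
  + intros X; apply hX.
- intros n XXs XX hXs hX; apply regular_FDC_reg.
  apply (@reg_mono (covered_by n XXs)).
  + apply reg_covered_by; intros i hi; now apply regular_FDC_reg, hXs.
  + intros X (A & hA & cov)%hX; exists A; split; auto.
    intros i hi; now apply is_subspace_roughly_in, hA.
- intros I X J U cov hU hY; apply regular_FDC_reg.
  apply (reg_union_permanence cov); [now apply regular_FDC_reg|].
  intros r hr; destruct (hY r hr) as (Y & h1 & h2); exists Y; split; auto.
  now apply regular_FDC_reg.
- intros I X H; apply regular_FDC_reg, reg_limit_permanence.
  intros r hr; destruct (H r hr) as (J & Y & h1 & h2); exists J, Y; split; auto.
  now apply regular_FDC_reg.
Qed.
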